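(* Let $(V,E,\mu,w)$ be a weighted graph and let $\Omega$ be a finite connected subset of $V$. Suppose that the Cheeger cut of $\Omega$ is unique, and denote it by $A$. For $p>1$ let $u_p$ be the normalized first eigenfunction of the Dirichlet $p$-Laplacian on $\Omega$. Then, pointwise on $V$, $$\lim_{p\to1^+}u_p=\frac1{|A|_\mu}\mathbf 1_A,$$ where $\mathbf 1_A$ denotes the characteristic function of $A$.
   Context: A weighted graph $(V,E,\mu,w)$ consists of a simple, undirected, locally finite graph $(V,E)$, a vertex measure $\mu:V\to(0,\infty)$, $x\mapsto\mu_x$, and an edge measure $w:E\to(0,\infty)$, $\{x,y\}\mapsto w_{xy}=w_{yx}$. Write $x\sim y$ if $\{x,y\}\in E$. For a finite set $D\subset V$, $|D|_\mu=\sum_{x\in D}\mu_x$; for a finite set $F\subset E$, $|F|_w=\sum_{\{x,y\}\in F}w_{xy}$. A (nonempty) subset $\Omega\subset V$ is connected if any $x,y\in\Omega$ can be joined by a path $x=x_0\sim x_1\sim\cdots\sim x_k=y$ with all $x_i\in\Omega$. $C_0(\Omega)$ is the set of functions $u:V\to\mathbb R$ vanishing on $V\setminus\Omega$, and for $p\ge1$, $|u|_p=\left(\sum_{x\in\Omega}|u(x)|^p\mu_x\right)^{1/p}$. For $p>1$, the Dirichlet $p$-Laplacian on $\Omega$ is $$\Delta_pu(x)=\frac1{\mu_x}\sum_{y\in V:\,y\sim x}w_{xy}|u(y)-u(x)|^{p-2}(u(y)-u(x)),\quad x\in\Omega,\ u\in C_0(\Omega),$$ with the convention $|t|^{p-2}t=0$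 for $t=0$. A pair $(\lambda,u)\in\mathbb R\times C_0(\Omega)$ with $u\ne0$ is an eigenvalue and eigenfunction if $-\Delta_pu(x)=\lambda|u(x)|^{p-2}u(x)$ for all $x\in\Omega$. The smallest eigenvalue is the first eigenvalue $\lambda_{1,p}(\Omega)$, and the associated eigenfunctions are the first eigenfunctions. For $\Omega$ finite and connected and $p>1$, it is known that first eigenfunctions have a fixed strict sign on $\Omega$ and are unique up to a nonzero multiplicative constant; the normalized first eigenfunction is the unique first eigenfunction $u$ with $u>0$ on $\Omega$ and $|u|_p=1$. For $D\subset V$, $\partial D=\{\{x,y\}\in E:x\in D,\ y\in V\setminus D\}$. The Cheeger constant of $\Omega$ is $h(\Omega)=\inf_{\emptyset\ne D\subset\Omega}\frac{|\partial D|_w}{|D|_\mu}$. A nonempty subset $D\subset\Omega$ is a Cheeger cut of $\Omega$ if $\frac{|\partial D|_w}{|D|_\mu}=h(\Omega)$. *)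

(* Defs.v *)
From HB Require Import structures.
From mathcomp Require Import all_boot all_order all_algebra.
From mathcomp Require Import all_classical all_reals all_analysis.
Set Implicit Arguments.
Unset Strict Implicit.
Unset Printing Implicit Defensive.
Import Order.TTheory GRing.Theory Num.Theory.
Import numFieldNormedType.Exports.
Local Open Scope classical_set_scope.
Local Open Scope ring_scope.

(* [emeas x y] is meaningful only when [adj x y]; its values on non-edges are
   unconstrained and never used. *)
Record weighted_graph (R : realType) (V : choiceType) := WeightedGraph {
  adj : rel V;
  adj_sym : symmetric adj;
  adj_irr : irreflexive adj;
  adj_locally_finite : forall x, finite_set [set y | adj x y];
  vmeas : V -> R;
  vmeas_gt0 : forall x, 0 < vmeas x;
  emeas : V -> V -> R;
  emeas_sym : forall x y, adj x y -> emeas x y = emeas y x;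
  emeas_gt0 : forall x y, adj x y -> 0 < emeas x y
}.

Definition graph_connected (R : realType) (V : choiceType)
    (G : weighted_graph R V) (Omega : set V) : Prop :=
  Omega !=set0 /\
  forall x y, Omega x -> Omega y ->
    exists s : seq V, [/\ path (adj G) x s, last x s = y &
      forall z, z \in x :: s -> Omega z].

Definition C0 (R : realType) (V : choiceType) (Omega : set V) (u : V -> R)
    : Prop :=
  forall x, ~ Omega x -> u x = 0.

(* The map t |-> |t|^(p-2) t; its value at 0 is 0 because of the factor t. *)
Definition sgnpow (R : realType) (p t : R) : R := `|t| `^ (p - 2) * t.

Definition pnorm (R : realType) (V : choiceType) (G : weighted_graph R V)
    (Omega : set V) (p : R) (u : V -> R) : R :=
  (\sum_(x \in Omega) `|u x| `^ p * vmeas G x) `^ p^-1.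

Definition plaplacian (R : realType) (V : choiceType) (G : weighted_graph R V)
    (p : R) (u : V -> R) (x : V) : R :=
  (vmeas G x)^-1 *
  \sum_(y \in [set y | adj G x y]) emeas G x y * sgnpow p (u y - u x).

Definition eigenpair (R : realType) (V : choiceType) (G : weighted_graph R V)
    (Omega : set V) (p lambda : R) (u : V -> R) : Prop :=
  [/\ C0 Omega u, exists x, u x != 0 &
    forall x, Omega x -> - plaplacian G p u x = lambda * sgnpow p (u x)].

Definition plap_eigenvalue (R : realType) (V : choiceType) (G : weighted_graph R V)
    (Omega : set V) (p lambda : R) : Prop :=
  exists u, eigenpair G Omega p lambda u.

Definition first_eigenvalue (R : realType) (V : choiceType)
    (G : weighted_graph R V) (Omega : set V) (p lambda : R) : Prop :=
  plap_eigenvalue G Omega p lambda /\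
  forall lambda', plap_eigenvalue G Omega p lambda' -> lambda <= lambda'.

Definition first_eigenfunction (R : realType) (V : choiceType)
    (G : weighted_graph R V) (Omega : set V) (p : R) (u : V -> R) : Prop :=
  exists2 lambda, first_eigenvalue G Omega p lambda &
    eigenpair G Omega p lambda u.

Definition normalized_first_eigenfunction (R : realType) (V : choiceType)
    (G : weighted_graph R V) (Omega : set V) (p : R) (u : V -> R) : Prop :=
  [/\ first_eigenfunction G Omega p u,
      forall x, Omega x -> 0 < u x & pnorm G Omega p u = 1].

Definition volume (R : realType) (V : choiceType) (G : weighted_graph R V)
    (D : set V) : R :=
  \sum_(x \in D) vmeas G x.

(* A boundary edge {x, y} has exactly one endpoint in D, so it is represented
   by the single ordered pair (x, y) with x in D and y outside D. *)
Definition edge_boundary (R : realType) (V : choiceType)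
    (G : weighted_graph R V) (D : set V) : set (V * V) :=
  [set e | [/\ adj G e.1 e.2, D e.1 & ~ D e.2]].

Definition boundary_weight (R : realType) (V : choiceType)
    (G : weighted_graph R V) (D : set V) : R :=
  \sum_(e \in edge_boundary G D) emeas G e.1 e.2.

Definition cheeger_ratio (R : realType) (V : choiceType)
    (G : weighted_graph R V) (D : set V) : R :=
  boundary_weight G D / volume G D.

Definition cheeger_constant (R : realType) (V : choiceType)
    (G : weighted_graph R V) (Omega : set V) : R :=
  inf [set cheeger_ratio G D | D in [set D | D !=set0 /\ D `<=` Omega]].

Definition cheeger_cut (R : realType) (V : choiceType)
    (G : weighted_graph R V) (Omega D : set V) : Prop :=
  [/\ D !=set0, D `<=` Omega & cheeger_ratio G D = cheeger_constant G Omega].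

(* Main.v *)
Require Import Defs.
From HB Require Import structures.
From mathcomp Require Import all_boot all_order all_algebra finmap.
From mathcomp Require Import all_classical all_reals all_analysis.
From mathcomp Require Import ring lra.
Set Implicit Arguments.
Unset Strict Implicit.
Unset Printing Implicit Defensive.
Import Order.TTheory GRing.Theory Num.Theory.
Import numFieldNormedType.Exports.
Local Open Scope classical_set_scope.
Local Open Scope ring_scope.

(* The convergence holds with an explicit linear rate in p - 1. Testing the
   eigenvalue equation against 1_A / u_p^(p-1) (Picone) gives lambda_p <= h, so
   the p-energy of u_p is at most h, and Young's inequality bounds its total
   variation by h + O(p-1), while |u_p|_1 = 1 + O(p-1). On the other hand, as
   Omega has finitely many subsets, every D <> A has Cheeger ratio at least
   h + d for some d > 0; peeling off superlevel sets one at a time (discrete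
   coarea formula) yields m >= 0 with m 1_A <= u_p and
   d (|u_p|_1 - m |A|) <= TV(u_p) - h |u_p|_1 = O(p-1). Hence u_p is
   O(p-1)-close to m 1_A and m |A| is O(p-1)-close to 1. *)

(** * Scalar inequalities for powers and for [sgnpow] *)

(** Young's inequality for [t * 1] with exponents [p] and [p / (p - 1)]; both [p^-1 <= 1] and
    [(p - 1) / p <= p - 1] then simplify the right side. *)
Lemma le_powR_affine (R : realType) (p t : R) : 1 < p -> 0 <= t ->
  t <= t `^ p + (p - 1).
Proof.
move=> p1 t0; have p0 : 0 < p by lra.
have q0 : 0 < 1 - p^-1 by rewrite subr_gt0 invf_lt1.
have /(_ _ 1 p _ t0 ler01 p0 _ _) H := @conjugate_powR R.
have := H (1 - p^-1)^-1; rewrite invr_gt0 q0 invrK mulr1 powR1 mul1r.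
move=> /(_ isT); rewrite addrCA subrr addr0 => /(_ erefl) /le_trans; apply.
have tp0 := powR_ge0 t p.
apply: lerD; first by rewrite ler_pdivrMr// ler_peMr// ltW.
have -> : 1 - p^-1 = (p - 1) / p by field; rewrite gt_eqF.
by rewrite ler_pdivrMr// ler_peMr; lra.
Qed.

Lemma powR_le_quadratic (R : realType) (p t : R) : 1 < p < 2 -> 0 <= t ->
  t `^ p <= t + (p - 1) * t ^+ 2.
Proof.
move=> /andP[p1 p2] t0.
have e0 : 0 < p - 1 by lra.
have q0 : 0 < (2 - p)^-1 by rewrite invr_gt0; lra.
have := @conjugate_powR R (t `^ (p - 1)) 1 (p - 1)^-1 (2 - p)^-1
  (powR_ge0 _ _) ler01.
rewrite invr_gt0 !invrK e0 q0 powR1 mul1r mulr1 -powRrM mulfV ?gt_eqF//.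
rewrite powRr1// => /(_ isT isT) H.
have {}H : t `^ (p - 1) <= t * (p - 1) + (2 - p) by apply: H; ring.
have : t * t `^ (p - 1) <= t * (t * (p - 1) + (2 - p)) by exact: ler_wpM2l.
rewrite mulr_powRB1//; last by lra.
by move=> /le_trans; apply; nra.
Qed.

Lemma sgnpowN (R : realType) (p t : R) : sgnpow p (- t) = - sgnpow p t.
Proof. by rewrite /sgnpow normrN mulrN. Qed.

Lemma mulr_sgnpow (R : realType) (p t : R) : 1 < p ->
  t * sgnpow p t = `|t| `^ p.
Proof.
move=> p1; rewrite /sgnpow; have [->|t0] := eqVneq t 0.
  by rewrite mul0r normr0 powR0// gt_eqF; lra.
have nt0 : 0 < `|t| by rewrite normr_gt0.
rewrite mulrCA -expr2 -real_normK ?num_real// -powR_mulrn// -powRD ?subrK//.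
by rewrite (gt_eqF nt0) implybT.
Qed.

Lemma ger0_sgnpow (R : realType) (p t : R) : 1 < p -> 0 <= t ->
  sgnpow p t = t `^ (p - 1).
Proof.
move=> p1; rewrite le_eqVlt => /predU1P[<-|t0].
  by rewrite /sgnpow mulr0 powR0// gt_eqF; lra.
apply: (mulfI (lt0r_neq0 t0)); rewrite mulr_sgnpow// gtr0_norm//.
by rewrite mulr_powRB1 ?ltW//; lra.
Qed.

Lemma sgnpow_le0 (R : realType) (p t : R) : t <= 0 -> sgnpow p t <= 0.
Proof. by move=> t0; rewrite mulr_ge0_le0 ?powR_ge0. Qed.

(** * Summation by parts, finite minima, total variation *)

(** Discrete Green formula: exchanging [x] and [y] turns the half with [- f y] into the half with
    [f x]. It serves to test the eigenvalue equation against [f]. *)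
Lemma sum_antisym_by_parts (R : realType) (T : Type) (s : seq T)
    (a k : T -> T -> R) (f : T -> R) :
  (forall x y, a x y = a y x) -> (forall x y, k x y = - k y x) ->
  \sum_(x <- s) \sum_(y <- s) a x y * ((f x - f y) * k x y) =
  2 * \sum_(x <- s) f x * \sum_(y <- s) a x y * k x y.
Proof.
move=> asym ksym; rewrite mulr2n mulrDl mul1r.
have E : \sum_(x <- s) f x * (\sum_(y <- s) a x y * k x y) =
    \sum_(x <- s) \sum_(y <- s) a x y * (- f y * k x y).
  rewrite exchange_big/=; apply: eq_bigr => x _; rewrite mulr_sumr.
  by apply: eq_bigr => y _; rewrite asym ksym; ring.
rewrite {2}E -big_split/=; apply: eq_bigr => x _; rewrite mulr_sumr -big_split/=.
by apply: eq_bigr => y _; ring.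
Qed.

Lemma seq_argmin (R : realType) (T : eqType) (f : T -> R) (s : seq T)
    (P : T -> Prop) :
  (exists2 x, x \in s & P x) ->
  exists2 x, x \in s /\ P x & forall y, y \in s -> P y -> f x <= f y.
Proof.
elim: s => [[]//|z s IH] [x xs Px].
have [[y ys Py]|H] := pselect (exists2 x, x \in s & P x); last first.
  have H' y : y \in z :: s -> P y -> y = z.
    by rewrite inE => /predU1P[//|ys Py]; case: H; exists y.
  by exists x => // y ys Py; rewrite (H' _ xs Px) (H' _ ys Py).
have [|w [ws Pw] wmin] := IH; first by exists y.
have [[Pz zw]|H] := pselect (P z /\ f z <= f w).
  exists z; first by rewrite mem_head.
  move=> v; rewrite inE => /predU1P[->//|vs Pv].
  by rewrite (le_trans zw)// wmin.
exists w; first by rewrite inE ws orbT.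
move=> v; rewrite inE => /predU1P[->|vs Pv]; last exact: wmin.
by move=> Pz; rewrite leNgt; apply/negP => zw; apply: H; split=> //; exact: ltW.
Qed.

(* Sums over ordered pairs: every edge counts twice, so constants below carry a
   factor 2 compared with [boundary_weight]. *)
Definition total_variation (R : realType) (T : Type) (s : seq T)
    (a : T -> T -> R) (f : T -> R) : R :=
  \sum_(x <- s) \sum_(y <- s) a x y * `|f x - f y|.

(** * Picone inequality and discrete coarea formula *)

Lemma picone_le_indicator (R : realType) (T : Type) (A : set T) (p : R)
    (u : T -> R) (x y : T) :
  1 < p -> (forall z, 0 <= u z) -> (forall z, A z -> 0 < u z) ->
  (\1_A x / u x `^ (p - 1) - \1_A y / u y `^ (p - 1)) * sgnpow p (u x - u y) <=
  `|\1_A x - \1_A y : R|.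
Proof.
move=> p1 u0 upos.
have pow_gt0 z : A z -> 0 < u z `^ (p - 1) by move=> /upos; exact: powR_gt0.
have pow_le (v w : R) : 0 <= v -> v <= w -> v `^ (p - 1) <= w `^ (p - 1).
  move=> v0 vw; apply: ge0_ler_powR => //; rewrite ?nnegrE//; first by lra.
  exact: le_trans vw.
have in_out z w : A z ->
    (u z `^ (p - 1))^-1 * sgnpow p (u z - u w) <= 1.
  move=> Az; have [zw|/ltW wz] := leP (u z) (u w).
    rewrite (@le_trans _ _ 0)// mulr_ge0_le0 ?invr_ge0 ?powR_ge0//.
    by rewrite sgnpow_le0// subr_le0.
  rewrite mulrC ler_pdivrMr ?pow_gt0// mul1r ger0_sgnpow ?subr_ge0//.
  by rewrite pow_le ?subr_ge0// gerBl.
have in_in z w : A z -> A w -> u z <= u w ->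
    ((u z `^ (p - 1))^-1 - (u w `^ (p - 1))^-1) * sgnpow p (u z - u w) <= 0.
  move=> Az Aw zw; rewrite mulr_ge0_le0 ?sgnpow_le0 ?subr_le0//.
  by rewrite subr_ge0 lef_pV2 ?posrE ?pow_gt0// pow_le.
rewrite !indicE; have [Ax|Ax] := pselect (A x); have [Ay|Ay] := pselect (A y).
- rewrite !mem_set// subrr normr0 !mul1r.
  have [xy|/ltW yx] := leP (u x) (u y); first exact: in_in.
  by rewrite -opprB mulNr -mulrN -sgnpowN opprB in_in.
- by rewrite mem_set// memNset// mul0r !subr0 mul1r normr1 in_out.
- rewrite memNset// mem_set// mul0r !sub0r mul1r normrN normr1 mulNr -mulrN.
  by rewrite -sgnpowN opprB in_out.
- by rewrite !memNset// !mul0r subrr mul0r normr0.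
Qed.

(* Induction on the support D of f: subtract [min_D f * \1_D]; the layers with
   D = A add up to m, each of the others contributes the gap d. *)
Lemma layer_cake (R : realType) (V : choiceType) (s : seq V)
    (a : V -> V -> R) (mu : V -> R) (Omega A : set V) (h d : R) (f : V -> R) :
  (forall x, Omega x -> x \in s) ->
  total_variation s a \1_A = h * \sum_(x <- s) mu x * \1_A x ->
  (forall D : set V, D !=set0 -> D `<=` Omega -> D <> A ->
    (h + d) * \sum_(x <- s) mu x * \1_D x <= total_variation s a \1_D) ->
  (forall x, 0 <= f x) -> C0 Omega f ->
  exists2 m, 0 <= m /\ (forall x, m * \1_A x <= f x) &
    d * (\sum_(x <- s) mu x * f x - m * \sum_(x <- s) mu x * \1_A x) <=
    total_variation s a f - h * \sum_(x <- s) mu x * f x.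
Proof.
move=> Os tvA gap f0 fO.
(* [F] only has to contain the support of [f]; its cardinality drives the induction. *)
have [F fF] : exists F : {fset V}, forall x, f x != 0 -> x \in F.
  exists (seq_fset tt s) => x fx; rewrite seq_fsetE; apply: Os.
  by apply: contrapT => /fO /eqP; apply/negP.
have [n] := ubnP #|` F|; elim: n => // n IH in f f0 fO F fF *.
rewrite ltnS => Fn.
have [[x fx]|f_eq0] := pselect (exists x, f x != 0); last first.
  have {}f_eq0 x : f x = 0.
    by apply: contrapT => /eqP fx; apply: f_eq0; exists x.
  exists 0; first by split=> // x; rewrite mul0r f_eq0.
  rewrite (_ : \sum_(x <- s) mu x * f x = 0); last first.
    by rewrite big1// => x _; rewrite f_eq0 mulr0.
  rewrite (_ : total_variation s a f = 0) ?mul0r ?mulr0 ?subrr ?mulr0//.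
  rewrite /total_variation big1// => x _.
  by rewrite big1// => y _; rewrite !f_eq0 subrr normr0 mulr0.
have [|x0 [x0F fx0] x0min] := @seq_argmin R V f F (fun x => f x != 0).
  by exists x => //; exact: fF.
set t := f x0; have t0 : 0 < t by rewrite lt_def fx0 f0.
have tmin y : f y != 0 -> t <= f y by move=> fy; rewrite x0min ?fF.
pose D := [set x | f x != 0].
have DE y : \1_D y = (f y != 0)%:R :> R.
  rewrite indicE; have [fy|fy] := boolP (f y != 0); first by rewrite mem_set.
  by rewrite memNset//; exact/negP.
pose g y := f y - t * \1_D y.
have g0 y : 0 <= g y.
  rewrite /g DE; have [->|fy] := eqVneq (f y) 0; first by rewrite mulr0 subrr.
  by rewrite mulr1 subr_ge0 tmin.
have gO : C0 Omega g.
  by move=> y /fO fy; rewrite /g DE fy eqxx mulr0 subrr.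
(* The minimizer [x0] leaves the support, so [F] loses a point. *)
have gF y : g y != 0 -> y \in (F `\ x0)%fset.
  rewrite !inE /g DE => gy; apply/andP; split.
    by apply: contra gy => /eqP ->; rewrite fx0 mulr1 subrr.
  by apply: fF; apply: contra gy => /eqP ->; rewrite eqxx mulr0 subrr.
have [|m [m0 mg] mtv] := IH g g0 gO (F `\ x0)%fset gF.
  by move: Fn; rewrite (cardfsD1 x0) x0F.
have sumE : \sum_(x <- s) mu x * f x =
    t * \sum_(x <- s) mu x * \1_D x + \sum_(x <- s) mu x * g x.
  rewrite mulr_sumr -big_split/=; apply: eq_bigr => y _; rewrite /g; ring.
(* Subtracting a constant on [D] leaves differences inside [D] unchanged; across its boundary the
   difference is a value [f y >= t], which splits as [t + (f y - t)]. *)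
have tvE : total_variation s a f =
    t * total_variation s a \1_D + total_variation s a g.
  rewrite /total_variation mulr_sumr -big_split/=; apply: eq_bigr => y _.
  rewrite mulr_sumr -big_split/=; apply: eq_bigr => z _.
  rewrite mulrCA -mulrDr; congr (_ * _); rewrite /g !DE.
  have [fy|fy] := eqVneq (f y) 0; have [fz|fz] := eqVneq (f z) 0.
  - by rewrite fy fz mulr0 !subrr normr0 mulr0 addr0.
  - have -> : f y - t * 0 - (f z - t * 1) = - (f z - t) by rewrite fy; ring.
    rewrite fy !sub0r !normrN normr1 !ger0_norm ?subr_ge0 ?tmin ?f0//; ring.
  - have -> : f y - t * 1 - (f z - t * 0) = f y - t by rewrite fz; ring.
    rewrite fz !subr0 normr1 !ger0_norm ?subr_ge0 ?tmin ?f0//; ring.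
  - by rewrite subrr normr0 mulr0 add0r !mulr1; congr (`|_|); ring.
(* If [D = A], the layer [t] joins [m] and has no excess variation, so neither side of the
   inequality changes. *)
have [DA|DA] := pselect (D = A).
  exists (t + m).
    split=> [|y]; first by rewrite addr_ge0// ltW.
    by rewrite mulrDl -lerBrDl -[in leRHS]DA; exact: mg.
  by rewrite sumE tvE -DA; rewrite -DA in mtv tvA; rewrite tvA; lra.
exists m.
  split=> // y; apply: (le_trans (mg y)).
  by rewrite gerBl mulr_ge0 ?(ltW t0)// indicE ler0n.
(* If [D <> A], [m] is kept: the left side grows by [d * t] times the mass of [D], and the gap makes
   the right side grow at least as much. *)
have /ler_wpM2l -/(_ _ (ltW t0)) : (h + d) * (\sum_(x <- s) mu x * \1_D x) <= total_variation s a \1_D.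
  apply: gap => //; first by exists x.
  by move=> y /= fy; apply: contrapT => /fO /eqP; apply/negP.
rewrite sumE tvE; move: mtv; move: (total_variation s a g) => tvg.
move: (total_variation s a \1_D) (\sum_(x <- s) mu x * g x) => tvD mug.
move: (\sum_(x <- s) mu x * \1_D x) (\sum_(x <- s) mu x * \1_A x) => muD muA.
by move=> ? ?; lra.
Qed.

(** * Eigenvalue and energy bounds *)

Lemma ler_sum_seq_term (R : realType) (T : eqType) (s : seq T) (F : T -> R) (x : T) :
  (forall y, 0 <= F y) -> x \in s -> F x <= \sum_(y <- s) F y.
Proof. by move=> F0 xs; rewrite (big_rem x xs)/= lerDl sumr_ge0. Qed.

Lemma barta_le (R : realType) (T : eqType) (s : seq T) (a : T -> T -> R)
    (mu : T -> R) (A : set T) (p lambda : R) (u : T -> R) :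
  (forall x y, a x y = a y x) -> (forall x y, 0 <= a x y) -> 1 < p ->
  (forall x, 0 <= u x) -> (forall x, A x -> 0 < u x) ->
  (forall x, A x -> \sum_(y <- s) a x y * sgnpow p (u x - u y) =
     lambda * (mu x * u x `^ (p - 1))) ->
  2 * lambda * (\sum_(x <- s) mu x * \1_A x) <= total_variation s a \1_A.
Proof.
move=> asym a0 p1 u0 upos eq_u.
pose k x y := sgnpow p (u x - u y).
have ksym x y : k x y = - k y x by rewrite /k -sgnpowN opprB.
have := sum_antisym_by_parts s (fun x => \1_A x / u x `^ (p - 1)) asym ksym.
have -> : \sum_(x <- s) \1_A x / u x `^ (p - 1) * (\sum_(y <- s) a x y * k x y) =
    lambda * \sum_(x <- s) mu x * \1_A x.
  rewrite mulr_sumr; apply: eq_bigr => x _.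
  have [Ax|Ax] := pselect (A x); last first.
    by rewrite indicE memNset// !mul0r !mulr0.
  have ? : u x `^ (p - 1) != 0 by rewrite gt_eqF// powR_gt0// upos.
  by rewrite eq_u//; field.
rewrite mulrA => <-; apply: ler_sum => x _; apply: ler_sum => y _.
by apply: ler_wpM2l => //; exact: picone_le_indicator.
Qed.

(** The equation tested against [u] itself. *)
Lemma energy_eigenfunction (R : realType) (T : eqType) (s : seq T) (a : T -> T -> R)
    (mu : T -> R) (p lambda : R) (u : T -> R) :
  (forall x y, a x y = a y x) -> 1 < p -> (forall x, 0 <= u x) ->
  (forall x, 0 < u x -> \sum_(y <- s) a x y * sgnpow p (u x - u y) =
     lambda * (mu x * u x `^ (p - 1))) ->
  \sum_(x <- s) \sum_(y <- s) a x y * `|u x - u y| `^ p =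
  2 * lambda * \sum_(x <- s) mu x * u x `^ p.
Proof.
move=> asym p1 u0 eq_u.
pose k x y := sgnpow p (u x - u y).
have ksym x y : k x y = - k y x by rewrite /k -sgnpowN opprB.
have := sum_antisym_by_parts s u asym ksym.
have -> : \sum_(x <- s) u x * (\sum_(y <- s) a x y * k x y) =
    lambda * \sum_(x <- s) mu x * u x `^ p.
  rewrite mulr_sumr; apply: eq_bigr => x _.
  rewrite -mulr_powRB1 ?u0//; last by lra.
  (* The equation is given only where [u] is positive; elsewhere both terms carry the factor
     [u x = 0]. *)
  have := u0 x; rewrite le_eqVlt => /predU1P[<-|ux]; first by rewrite !mul0r !mulr0.
  by rewrite eq_u//; ring.
rewrite mulrA => <-; apply: eq_bigr => x _; apply: eq_bigr => y _.
by rewrite mulr_sgnpow.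
Qed.

(** * Mass bounds and the linear rate *)

Definition edge_mass (R : realType) (T : Type) (s : seq T) (a : T -> T -> R) : R :=
  \sum_(x <- s) \sum_(y <- s) a x y.

(* [(mu x)^-1 + 1] bounds [u x] whenever [\sum mu x * u x `^ p = 1]. *)
Definition mass_defect (R : realType) (T : Type) (s : seq T) (mu : T -> R) : R :=
  \sum_(x <- s) mu x * ((mu x)^-1 + 1) ^+ 2.

(** The affine bound on [t] gives the upper estimate. For the lower one, each term of the normalized
    sum is at most 1, which bounds [u x] uniformly in [p] and controls the quadratic error. *)
Lemma mass_bounds (R : realType) (T : eqType) (s : seq T) (mu : T -> R)
    (p : R) (u : T -> R) :
  (forall x, 0 < mu x) -> 1 < p < 2 -> (forall x, 0 <= u x) ->
  \sum_(x <- s) mu x * u x `^ p = 1 ->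
  1 - mass_defect s mu * (p - 1) <= \sum_(x <- s) mu x * u x <=
  1 + (\sum_(x <- s) mu x) * (p - 1).
Proof.
move=> mu0 p12 u0 up1; have /andP[p1 p2] := p12; apply/andP; split.
  rewrite lerBlDr -{1}up1 mulr_suml -big_split/= big_seq [leRHS]big_seq.
  apply: ler_sum => x xs.
  have muup : mu x * u x `^ p <= 1.
    rewrite -up1; apply: (@ler_sum_seq_term R T s (fun x => mu x * u x `^ p)) => // y.
    by rewrite mulr_ge0 ?powR_ge0// ltW.
  have ux : u x <= (mu x)^-1 + 1.
    apply: (le_trans (le_powR_affine p1 (u0 x))); apply: lerD; last by lra.
    by rewrite -[leRHS]mulr1 ler_pdivlMl.
  rewrite -mulrA -mulrDr ler_pM2l//.
  apply: (le_trans (powR_le_quadratic p12 (u0 x))); rewrite lerD2l [leLHS]mulrC.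
  by rewrite ler_pM2r ?subr_gt0// lerXn2r// nnegrE// addr_ge0// invr_ge0 ltW.
rewrite -{1}up1 mulr_suml -big_split/=; apply: ler_sum => x _.
by rewrite -mulrDr ler_pM2l//; exact: le_powR_affine.
Qed.

(** The point is the order of quantifiers: [C] is chosen before [p], [lambda] and [u]. As sums run
    over ordered pairs, [h] and [d] stand for twice the Cheeger constant and twice the gap. *)
Lemma eigenfunction_rate (R : realType) (V : choiceType) (s : seq V)
    (a : V -> V -> R) (mu : V -> R) (Omega A : set V) (h d : R) (x : V) :
  (forall x y, a x y = a y x) -> (forall x y, 0 <= a x y) ->
  (forall x, 0 < mu x) ->
  A !=set0 -> A `<=` Omega -> (forall x, Omega x -> x \in s) ->
  total_variation s a \1_A = h * (\sum_(x <- s) mu x * \1_A x) -> 0 < d ->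
  (forall D : set V, D !=set0 -> D `<=` Omega -> D <> A ->
    (h + d) * \sum_(x <- s) mu x * \1_D x <= total_variation s a \1_D) ->
  exists C : R, forall (p lambda : R) (u : V -> R), 1 < p < 2 ->
    (forall x, 0 <= u x) -> (forall x, Omega x -> 0 < u x) -> C0 Omega u ->
    \sum_(x <- s) mu x * u x `^ p = 1 ->
    (forall x, Omega x -> \sum_(y <- s) a x y * sgnpow p (u x - u y) =
       lambda * (mu x * u x `^ (p - 1))) ->
    `|u x - (\sum_(x <- s) mu x * \1_A x)^-1 * \1_A x| <= C * (p - 1).
Proof.
move=> asym a0 mu0 [z Az] AO Os tvA d0 gap.
set vA := \sum_(x <- s) mu x * \1_A x in tvA *.
have ind0 y : 0 <= \1_A y :> R by rewrite indicE.
have muind0 y : 0 <= mu y * \1_A y by rewrite mulr_ge0// ltW.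
have vA0 : 0 < vA.
  apply: (@lt_le_trans _ _ (mu z * \1_A z)); first by rewrite indicE mem_set// mulr1.
  by apply: (@ler_sum_seq_term R V s (fun x => mu x * \1_A x)) => //; exact/Os/AO.
have h0 : 0 <= h.
  rewrite -(pmulr_lge0 _ vA0) -tvA.
  by apply: sumr_ge0 => y _; apply: sumr_ge0 => w _; rewrite mulr_ge0.
set W := edge_mass s a; set K := mass_defect s mu; set M := \sum_(x <- s) mu x.
(* With [e = p - 1]: [d * (L - m * vA) <= TV - h * L <= (h + W * e) - h * (1 - K * e) = (W + h * K)
   * e]. *)
pose C1 := (W + h * K) / d.
(* The first summand bounds [u x - m * \1_A x], the second [m - vA^-1]. *)
exists (C1 / mu x + (C1 + K + M) / vA) => p lambda u p12 u0 upos uO up1 eq_u.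
have /andP[p1 p2] := p12; have e0 : 0 < p - 1 by lra.
have eigen_le : 2 * lambda <= h.
  rewrite -(ler_pM2r vA0) -tvA; apply: (@barta_le R V s a mu A p lambda u) => // y Ay.
    exact/upos/AO.
  exact/eq_u/AO.
have tv_le : total_variation s a u <= h + W * (p - 1).
  apply: (@le_trans _ _ (2 * lambda + W * (p - 1))); last by rewrite lerD2r.
  have := @energy_eigenfunction R V s a mu p lambda u asym p1 u0.
  rewrite up1 mulr1 => <-; last first.
    move=> y uy; apply: eq_u; apply: contrapT => /uO uy0.
    by rewrite uy0 ltxx in uy.
  rewrite mulr_suml -big_split; apply: ler_sum => y _.
  rewrite mulr_suml -big_split; apply: ler_sum => w _.
  by rewrite /= -mulrDr ler_wpM2l// le_powR_affine.
have [m [m0 mu_le] mtv] := layer_cake Os tvA gap u0 uO.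
have /andP[] := mass_bounds mu0 p12 u0 up1.
rewrite -/vA -/K -/M in mtv *; set L := \sum_(x <- s) mu x * u x in mtv *.
move=> L_ge L_le.
have close : L - m * vA <= C1 * (p - 1).
  rewrite /C1 mulrAC ler_pdivlMr// mulrC.
  apply: (le_trans mtv); have : h * (1 - K * (p - 1)) <= h * L by exact: ler_wpM2l.
  by move: tv_le; lra.
have termwise y : 0 <= mu y * (u y - m * \1_A y).
  by rewrite mulr_ge0 ?subr_ge0// ltW.
have LE : L - m * vA = \sum_(x <- s) mu x * (u x - m * \1_A x).
  by rewrite /L /vA mulr_sumr -sumrB; apply: eq_bigr => y _; ring.
have L_gt : m * vA <= L by rewrite -subr_ge0 LE sumr_ge0.
(* [m * vA] lies between [L - C1 * (p - 1)] and [L], and [L] is near 1 by the mass bounds. *)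
have m_close : `|m - vA^-1| <= (C1 + K + M) / vA * (p - 1).
  have -> : m - vA^-1 = (m * vA - 1) / vA by field; rewrite gt_eqF.
  rewrite normrM [X in _ * X]gtr0_norm ?invr_gt0// mulrAC ler_pM2r ?invr_gt0//.
  have K0 : 0 <= K * (p - 1).
    rewrite mulr_ge0 ?(ltW e0)// sumr_ge0// => y _.
    by rewrite mulr_ge0 ?sqr_ge0// ltW.
  have M0 : 0 <= M * (p - 1).
    by rewrite mulr_ge0 ?(ltW e0)// sumr_ge0// => y _; rewrite ltW.
  by rewrite ler_norml; apply/andP; split; lra.
have u_close : u x - m * \1_A x <= C1 / mu x * (p - 1).
  rewrite mulrAC ler_pdivlMr// mulrC.
  (* For [x] in [s], one term of a sum of nonnegative terms; otherwise [x] is outside [Omega], where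
     [u] and [\1_A] vanish. *)
  have [xs|xs] := boolP (x \in s).
    apply: le_trans close; rewrite LE.
    exact: (@ler_sum_seq_term R V s (fun x => mu x * (u x - m * \1_A x))).
  have nOx : ~ Omega x by move=> /Os; exact/negP.
  rewrite uO// indicE memNset; last by move=> /AO.
  by rewrite !mulr0 subrr mulr0; apply: le_trans close; rewrite subr_ge0.
have -> : u x - vA^-1 * \1_A x = (u x - m * \1_A x) + (m - vA^-1) * \1_A x by ring.
rewrite [leRHS]mulrDl; apply: (le_trans (ler_normD _ _)); apply: lerD.
  by rewrite ger0_norm// subr_ge0.
rewrite normrM; apply: le_trans m_close; rewrite ler_piMr//.
by rewrite indicE; case: (_ \in _); rewrite ?normr1 ?normr0.
Qed.

(** * Graph quantities as sums over one finite list *)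

Lemma fsum_indicator (R : realType) (T : choiceType) (S D : set T) (F : T -> R) :
  finite_set S -> D `<=` S ->
  \sum_(x \in D) F x = \sum_(x <- fset_set S) F x * \1_D x.
Proof.
move=> Sfin DS.
transitivity (\sum_(x \in S) F x * \1_D x); last exact: fsbig_finite.
rewrite -[RHS](@fsbig_widen _ _ _ _ D)//.
  by apply: eq_fsbigr => x; rewrite inE => Dx; rewrite indicE mem_set// mulr1.
by move=> x [_ nDx] /=; rewrite indicE memNset// mulr0.
Qed.

Section GraphSums.
Context (R : realType) (V : choiceType) (G : weighted_graph R V) (Omega : set V).
Context (Omega_fin : finite_set Omega).

(** Contains both endpoints of every edge that meets [Omega], so one finite list carries all the
    sums. *)
Definition closed_nbhd : set V :=
  Omega `|` \bigcup_(x in Omega) [set y | adj G x y].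

(** Cutting off to 0 on non-edges, where [emeas] is arbitrary, gives a kernel that is symmetric and
    nonnegative on all pairs. *)
Definition edge_weight (x y : V) : R := if adj G x y then emeas G x y else 0.

Lemma closed_nbhd_finite : finite_set closed_nbhd.
Proof.
rewrite finite_setU; split=> //; apply: bigcup_finite => // x _.
exact: adj_locally_finite.
Qed.

Lemma edge_weight_sym x y : edge_weight x y = edge_weight y x.
Proof.
rewrite /edge_weight adj_sym; case: ifP => // yx.
by rewrite emeas_sym// adj_sym.
Qed.

Lemma edge_weight_ge0 x y : 0 <= edge_weight x y.
Proof. by rewrite /edge_weight; case: ifP => // /emeas_gt0 /ltW. Qed.

(** The ordered double sum meets each boundary edge in both orders, [boundary_weight] only in the
    order leaving [D]. *)
Lemma total_variation_indicator (D : set V) : D `<=` Omega ->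
  total_variation (fset_set closed_nbhd) edge_weight \1_D =
  2 * boundary_weight G D.
Proof.
move=> DO; set S := closed_nbhd; have Sfin : finite_set S := closed_nbhd_finite.
pose F x y := emeas G x y * \1_(edge_boundary G D) (x, y).
have -> : boundary_weight G D =
    \sum_(x <- fset_set S) \sum_(y <- fset_set S) F x y.
  transitivity (\sum_(x \in S) \sum_(y \in S) F x y).
    rewrite pair_fsbig// /boundary_weight.
    rewrite -[RHS](@fsbig_widen _ _ _ _ (edge_boundary G D)).
    - apply: eq_fsbigr => -[x y]; rewrite inE => exy.
      by rewrite /F indicE mem_set// mulr1.
    - move=> [x y] [/= xy Dx nDy]; split=> /=; first by left; exact: DO.
      by right; exists x => //; exact: DO.
    - by move=> [x y] [_ nxy] /=; rewrite /F indicE memNset// mulr0.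
  rewrite fsbig_finite//; apply: eq_bigr => x _.
  by rewrite fsbig_finite.
rewrite mulr2n mulrDl mul1r [X in _ + X]exchange_big -big_split.
apply: eq_bigr => x _; rewrite -big_split/=; apply: eq_bigr => y _.
rewrite /edge_weight /F !indicE; case: ifPn => xy; last first.
  rewrite mul0r !memNset ?mulr0 ?addr0//; move=> [/= + _ _]; last exact/negP.
  by rewrite adj_sym; exact/negP.
rewrite (emeas_sym xy).
have yx : adj G y x by rewrite adj_sym.
have bE z w : adj G z w ->
    ((z, w) \in edge_boundary G D) = (z \in D) && (w \notin D).
  move=> zw; apply/idP/andP; rewrite !inE => -[].
    by move=> _ Dz nDw; split=> //; apply/negP; rewrite inE.
  by move=> Dz /negP; rewrite inE => nDw; split.
rewrite !bE//; case: (x \in D); case: (y \in D) => /=.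
- by rewrite subrr normr0 !mulr0 addr0.
- by rewrite subr0 normr1 mulr1 mulr0 addr0.
- by rewrite sub0r normrN normr1 mulr1 mulr0 add0r.
- by rewrite subrr normr0 !mulr0 addr0.
Qed.

Lemma plaplacian_sum (p : R) (u : V -> R) (x : V) : Omega x ->
  \sum_(y <- fset_set closed_nbhd) edge_weight x y * sgnpow p (u x - u y) =
  vmeas G x * - plaplacian G p u x.
Proof.
move=> Ox; rewrite /plaplacian mulrN mulrA divff ?gt_eqF ?vmeas_gt0// mul1r.
rewrite (fsum_indicator _ closed_nbhd_finite); last by move=> y xy; right; exists x.
rewrite -sumrN; apply: eq_bigr => y _.
rewrite -opprB sgnpowN /edge_weight indicE; case: ifPn => xy.
  by rewrite mem_set// mulr1 mulrN.
by rewrite memNset ?mulr0 ?oppr0 ?mul0r//; exact/negP.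
Qed.

Lemma cheeger_constant_le (D : set V) : D !=set0 -> D `<=` Omega ->
  cheeger_constant G Omega <= cheeger_ratio G D.
Proof.
move=> D0 DO; apply: ge_inf; last by exists D.
exists 0 => _ [B _ <-]; rewrite divr_ge0//.
  apply: fsumr_ge0 => -[x y] [/= xy _ _]; exact/ltW/emeas_gt0.
by apply: fsumr_ge0 => x _; exact/ltW/vmeas_gt0.
Qed.

Lemma volume_gt0 (D : set V) : D !=set0 -> D `<=` Omega -> 0 < volume G D.
Proof.
move=> [x Dx] DO; have Dfin := sub_finite_set DO Omega_fin.
rewrite /volume fsbig_finite//.
apply: (lt_le_trans (vmeas_gt0 G x)).
apply: (ler_sum_seq_term (F := vmeas G)); last by rewrite in_fset_set// mem_set.
by move=> y; exact/ltW/vmeas_gt0.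
Qed.

(** Among the finitely many nonempty subsets other than [A] the least ratio is attained, and it
    exceeds the Cheeger constant because its minimizer is not a cut. *)
Lemma cheeger_gap (A : set V) :
  (forall B : set V, cheeger_cut G Omega B -> B = A) ->
  exists2 d : R, 0 < d & forall D : set V, D !=set0 -> D `<=` Omega -> D <> A ->
    (cheeger_constant G Omega + d) * volume G D <= boundary_weight G D.
Proof.
move=> A_unique; pose P (F : {fset V}) := [set` F] !=set0 /\ [set` F] <> A.
pose ratio (F : {fset V}) := cheeger_ratio G [set` F].
set h := cheeger_constant G Omega.
have key d : (forall F : {fset V}, F \in fpowerset (fset_set Omega) -> P F ->
    h + d <= ratio F) ->
    forall D : set V, D !=set0 -> D `<=` Omega -> D <> A ->
    (h + d) * volume G D <= boundary_weight G D.
  move=> hd D D0 DO DA; rewrite -ler_pdivlMr ?volume_gt0//.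
  have Dfin := sub_finite_set DO Omega_fin.
  rewrite -/(cheeger_ratio G D) -(fset_setK Dfin); apply: hd; last first.
    by split; rewrite fset_setK.
  rewrite fpowersetE; apply/fsubsetP => x; rewrite !in_fset_set// !inE; exact: DO.
(* Without any competitor to [A] the claim is vacuous and [d = 1] serves. *)
have [ex|nex] := pselect (exists2 F, F \in fpowerset (fset_set Omega) & P F); last first.
  by exists 1 => //; apply: key => F ? ?; case: nex; exists F.
have [F [FO [F0 FA]] Fmin] := seq_argmin ratio ex.
exists (ratio F - h); last by apply: key => B BO PB; rewrite subrKC Fmin.
have FOm : [set` F] `<=` Omega.
  move: FO; rewrite fpowersetE => /fsubsetP FO x /= /FO.
  by rewrite in_fset_set// inE.
rewrite subr_gt0 lt_neqAle cheeger_constant_le// andbT; apply/eqP => hF.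
by apply: FA; apply: A_unique; split.
Qed.

End GraphSums.

(** * Passage to the limit from the uniform rate *)

Theorem corollary0p3 (R : realType) (V : choiceType) (G : weighted_graph R V)
    (Omega : set V) (Omega_fin : finite_set Omega)
    (Omega_conn : graph_connected G Omega)
    (A : set V) (A_cut : cheeger_cut G Omega A)
    (A_unique : forall B : set V, cheeger_cut G Omega B -> B = A)
    (u : R -> V -> R)
    (u_first : forall p : R, 1 < p ->
       normalized_first_eigenfunction G Omega p (u p)) :
  forall x : V, u p x @[p --> (1 : R)^'+] --> (volume G A)^-1 * \1_A x.
Proof.
move=> x; have [A0 AO ratioA] := A_cut.
have [d d0 gap] := cheeger_gap Omega_fin A_unique.
have Sfin := closed_nbhd_finite G Omega_fin.
set S := closed_nbhd G Omega in Sfin; pose s := fset_set S.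
have OS : Omega `<=` S by move=> y; left.
have Os y : Omega y -> y \in s by move=> /OS Sy; rewrite in_fset_set// mem_set.
have volE D : D `<=` Omega ->
    volume G D = \sum_(y <- s) vmeas G y * \1_D y.
  by move=> DO; apply: fsum_indicator => //; exact: subset_trans OS.
have d20 : 0 < 2 * d by lra.
have tvA : total_variation s (edge_weight G) \1_A =
    2 * cheeger_constant G Omega * (\sum_(y <- s) vmeas G y * \1_A y).
  rewrite total_variation_indicator// -volE// -ratioA -mulrA divfK//.
  by rewrite gt_eqF// (volume_gt0 G Omega_fin).
have gap2 D : D !=set0 -> D `<=` Omega -> D <> A ->
    (2 * cheeger_constant G Omega + 2 * d) *
      (\sum_(y <- s) vmeas G y * \1_D y) <=
    total_variation s (edge_weight G) \1_D.
  move=> D0 DO DA; rewrite total_variation_indicator// -volE//.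
  by rewrite -mulrDr -mulrA ler_pM2l// gap.
have [C rate] := eigenfunction_rate x (edge_weight_sym G) (edge_weight_ge0 G)
  (vmeas_gt0 G) A0 AO Os tvA d20 gap2.
have {}rate p : 1 < p < 2 ->
    `|u p x - (volume G A)^-1 * \1_A x| <= C * (p - 1).
  move=> p12; have /andP[p1 _] := p12.
  have [[lambda _ [uO _ eq_u]] upos norm1] := u_first p p1.
  have u0 y : 0 <= u p y.
    have [Oy|/uO ->//] := pselect (Omega y); exact/ltW/upos.
  rewrite volE//; apply: (rate p lambda) => //.
    have p0 : 0 < p by lra.
    move: norm1; rewrite /pnorm (fsum_indicator _ Sfin OS) => norm1.
    have E : \sum_(y <- s) vmeas G y * u p y `^ p =
        \sum_(y <- s) `|u p y| `^ p * vmeas G y * \1_Omega y.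
      apply: eq_bigr => y _; rewrite ger0_norm// indicE.
      have [Oy|nOy] := pselect (Omega y).
        by rewrite mem_set// mulr1 mulrC.
      by rewrite uO// powR0 ?mulr0 ?mul0r// gt_eqF.
    have sum0 : 0 <= \sum_(y <- s) vmeas G y * u p y `^ p.
      by apply: sumr_ge0 => y _; rewrite mulr_ge0 ?powR_ge0// ltW// vmeas_gt0.
    move: norm1; rewrite -E => /(congr1 (fun r : R => r `^ p)).
    by rewrite -powRrM mulVf ?gt_eqF// powRr1// powR1.
  move=> y Oy; rewrite plaplacian_sum// eq_u// ger0_sgnpow//; ring.
apply/cvgrPdist_le => e e0; near=> p.
(* [C] has no known sign, so it is replaced by a positive bound before dividing. *)
have C0' : 0 < `|C| + 1 by rewrite ltr_wpDl.
rewrite distrC; apply: (@le_trans _ _ (C * (p - 1))).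
  by apply: rate; apply/andP; split; near: p;
    [exact: nbhs_right_gt|apply: nbhs_right_lt; lra].
have p1 : 0 <= p - 1.
  by rewrite subr_ge0; near: p; exact: nbhs_right_ge.
apply: (@le_trans _ _ ((`|C| + 1) * (p - 1))).
  by apply: ler_wpM2r => //; have := ler_norm C; lra.
rewrite mulrC -ler_pdivlMr//; apply: ltW; near: p.
by apply: nbhs_right_ltDr; exact: divr_gt0.
Unshelve. all: by end_near. Qed.
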